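(* The number line is partitioned as $0 < \Phi^{+} < \mathbb{R}^{+} + \Phi < +\Phi^{-1} < \infty$. That is: for every $\delta \in \Phi^{+}$, every $x \in \mathbb{R}^{+}$ and $\eta \in \Phi$, and every $\omega \in +\Phi^{-1}$, one has $0 < \delta < x + \eta < \omega < \infty$.
   Context: $*G$ denotes the gossamer number system: numbers built from the finite integers together with infinite integers (integers larger in magnitude than every finite integer) in the same way that the reals are built from the integers. It is taken to be a totally ordered field containing the ordered field $\mathbb{R}$ as a subfield and containing infinite numbers. A number in $*G$ is a positive (negative) infinite number, or infinity, if it is larger (smaller) than every real number. $\Phi^{-1}$ is the set of all infinities (positive or negative) and $+\Phi^{-1}$ the set of positive ones. $\Phi = \{x \in *G\setminus\{0\} : 1/x \in \Phi^{-1}\}$ is the set of infinitesimals (so $0 \notin \Phi$) and $\Phi^{+}$ is the set of positive infinitesimals. $\mathbb{R}^{+}$ is the set of positive reals. The symbol $\infty$ is a single element adjoined to $*G$, not belonging to $\Phi^{-1}$, and defined to satisfy $|\omega| < \infty$ for all $\omega\in\Phi^{-1}$. For sets $A,B$, $A<B$ means every element of $A$ is less than every element of $B$, and $A+B=\{a+b: a\in A, b\in B\}$. *)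

(* Defs.v *)
From HB Require Import structures.
From mathcomp Require Import all_boot all_order all_algebra.
From mathcomp Require Import all_classical all_reals.

Set Implicit Arguments.
Unset Strict Implicit.
Unset Printing Implicit Defensive.

Import Order.TTheory GRing.Theory Num.Theory.

Local Open Scope classical_set_scope.
Local Open Scope ring_scope.

(* The field G with a single new element Infty adjoined. *)
Variant line (G : Type) : Type := Elt of G | Infty.
Arguments Infty {G}.

Section Gossamer.
Variables (R : realType) (G : realFieldType) (iota : {rmorphism R -> G}).

Definition pos_infinities : set G := [set w | forall r : R, iota r < w].

Definition neg_infinities : set G := [set w | forall r : R, w < iota r].

Definition infinities : set G := pos_infinities `|` neg_infinities.

(* 0^-1 = 0 in MathComp, whence the explicit x != 0. *)
Definition infinitesimals : set G := [set x | x != 0 /\ infinities x^-1].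

Definition pos_infinitesimals : set G := infinitesimals `&` [set x | 0 < x].

Definition pos_reals : set G := [set iota r | r in [set r : R | 0 < r]].

(* R is an ordered subfield of G through iota, and G has infinite elements. *)
Definition is_gossamer : Prop :=
  {mono iota : x y / x <= y} /\ infinities !=set0.

(* The order on line G is the transitive relation generated by the order of G
   and by the defining inequalities |w| < Infty for infinite w. *)
Inductive line_lt : line G -> line G -> Prop :=
  | line_lt_elt x y : x < y -> line_lt (Elt x) (Elt y)
  | line_lt_infty w : infinities w -> line_lt (Elt `|w|) Infty
  | line_lt_trans a b c : line_lt a b -> line_lt b c -> line_lt a c.

Definition set_lt (A B : set (line G)) : Prop :=
  forall a b, A a -> B b -> line_lt a b.

Lemma line_ltNinfty a : ~ line_lt Infty a.
Proof.
suff H b : line_lt b a -> b <> Infty by move=> /H.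
by elim.
Qed.

Lemma line_lt_eltE x y : line_lt (Elt x) (Elt y) <-> x < y.
Proof.
split; last exact: line_lt_elt.
suff H a b : line_lt a b ->
    forall u v, a = Elt u -> b = Elt v -> u < v by move=> /H; apply.
elim=> {a b} [a b ab _ _ [<-] [<-] //|//|a [b|] c _ IH1 bc IH2 u v au cv].
  exact: lt_trans (IH1 _ _ au erefl) (IH2 _ _ erefl cv).
by case: (line_ltNinfty bc).
Qed.

Lemma line_lt_irr a : ~ line_lt a a.
Proof.
case: a => [x|]; last exact: line_ltNinfty.
by move=> /line_lt_eltE; rewrite ltxx.
Qed.

End Gossamer.

(* Main.v *)
(* Inverting |1/x| > 1/r shows that an infinitesimal is smaller in magnitude than
   every positive real r.  With r = x/2 applied to delta and to eta this gives
   delta < x + eta; with r = 1 it gives x + eta < x + 1, a real number, hence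
   below every positive infinity. *)
Require Import Defs.
From mathcomp Require Import all_boot all_order all_algebra.
From mathcomp Require Import all_classical all_reals.
Import Order.TTheory GRing.Theory Num.Theory.
Local Open Scope classical_set_scope.
Local Open Scope ring_scope.

(** Passing to [|w|] merges the two signs of infinity, so that infinitesimals of either sign can
    later be treated by a single inversion. *)
Lemma infinities_norm_gt (R : realType) (G : realFieldType)
    (iota : {rmorphism R -> G}) (w : G) (r : R) :
  infinities iota w -> iota r < `|w|.
Proof.
move=> [hw|hw]; first exact: lt_le_trans (hw r) (ler_norm w).
(* A negative infinity lies below the real [- r], hence [- w] lies above [r]. *)
rewrite -normrN; apply: lt_le_trans (ler_norm (- w)).
by rewrite ltrNr -rmorphN.
Qed.

Lemma infinitesimals_norm_lt (R : realType) (G : realFieldType)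
    (iota : {rmorphism R -> G}) (x : G) (r : R) :
  {mono iota : x y / x <= y} -> infinitesimals iota x -> 0 < r ->
  `|x| < iota r.
Proof.
move=> iota_le [x0 hx] r0.
have iota_r0 : 0 < iota r by rewrite -(rmorph0 iota) (leW_mono iota_le).
(* Inversion reverses the order between positive elements, and [x != 0] makes [|x|] positive. As
   [iota] commutes with inverses, the bound to beat is the image of the real [r^-1]. *)
rewrite -ltf_pV2 ?posrE ?normr_gt0// -normfV -fmorphV.
exact: infinities_norm_gt.
Qed.

Lemma pos_infinitesimal_lt (R : realType) (G : realFieldType)
    (iota : {rmorphism R -> G}) (delta eta : G) (x : R) :
  {mono iota : x y / x <= y} -> infinitesimals iota delta ->
  infinitesimals iota eta -> 0 < x -> delta < iota x + eta.
Proof.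
move=> iota_le hd he x0.
have x20 : 0 < x / 2 by rewrite divr_gt0.
have := infinitesimals_norm_lt _ _ _ _ _ iota_le hd x20.
have := infinitesimals_norm_lt _ _ _ _ _ iota_le he x20.
rewrite !ltr_norml => /andP[he1 _] /andP[_ hd1].
have -> : iota x = iota (x / 2) + iota (x / 2) by rewrite -rmorphD -splitr.
(* One half of [x] exceeds [delta]; the other absorbs a possibly negative [eta], leaving
   [iota (x / 2) + eta] nonnegative. *)
by rewrite -addrA; apply: lt_le_trans hd1 _; rewrite lerDl -lerBlDl sub0r ltW.
Qed.

Lemma finite_lt_pos_infinity (R : realType) (G : realFieldType)
    (iota : {rmorphism R -> G}) (eta omega : G) (x : R) :
  {mono iota : x y / x <= y} -> infinitesimals iota eta ->
  pos_infinities iota omega -> iota x + eta < omega.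
Proof.
move=> iota_le he homega.
apply: lt_trans (homega (x + 1)); rewrite rmorphD ltrD2l.
exact: le_lt_trans (ler_norm eta) (infinitesimals_norm_lt _ _ _ _ _ iota_le he ltr01).
Qed.

(** The generating inequality for [Infty] concerns only absolute values; [omega] is its own, since
    it exceeds the real 0. *)
Lemma pos_infinity_lt_Infty (R : realType) (G : realFieldType)
    (iota : {rmorphism R -> G}) (omega : G) :
  pos_infinities iota omega -> line_lt iota (Elt omega) Infty.
Proof.
move=> homega.
have omega0 : 0 < omega by rewrite -(rmorph0 iota); exact: homega.
by rewrite -(gtr0_norm omega0); apply: line_lt_infty; left.
Qed.

Theorem theorem1p1 (R : realType) (G : realFieldType)
    (iota : {rmorphism R -> G}) (hG : is_gossamer iota) :
  [/\ set_lt iota [set Elt 0] [set Elt d | d in pos_infinitesimals iota],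
      set_lt iota [set Elt d | d in pos_infinitesimals iota]
        [set Elt (a + b) | a in pos_reals iota & b in infinitesimals iota],
      set_lt iota
        [set Elt (a + b) | a in pos_reals iota & b in infinitesimals iota]
        [set Elt w | w in pos_infinities iota]
    & set_lt iota [set Elt w | w in pos_infinities iota] [set Infty]] /\
  (forall (delta : G) (x : R) (eta omega : G),
     pos_infinitesimals iota delta -> 0 < x -> infinitesimals iota eta ->
     pos_infinities iota omega ->
     [/\ line_lt iota (Elt 0) (Elt delta),
         line_lt iota (Elt delta) (Elt (iota x + eta)),
         line_lt iota (Elt (iota x + eta)) (Elt omega)
       & line_lt iota (Elt omega) Infty]).
Proof.
have [iota_le _] := hG.
split; first split.
- by move=> _ _ -> [d [_ d0] <-]; exact: line_lt_elt.
- move=> _ _ [d [hd _] <-] [_ [x x0 <-] [e he <-]].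
  by apply: line_lt_elt; exact: pos_infinitesimal_lt.
- move=> _ _ [_ [x _ <-] [e he <-]] [w hw <-].
  by apply: line_lt_elt; exact: finite_lt_pos_infinity.
- by move=> _ _ [w hw <-] ->; exact: pos_infinity_lt_Infty.
(* The elementwise chain follows from the same comparisons. *)
move=> delta x eta omega [hd d0] x0 he hw; split.
- exact: line_lt_elt.
- by apply: line_lt_elt; exact: pos_infinitesimal_lt.
- by apply: line_lt_elt; exact: finite_lt_pos_infinity.
- exact: pos_infinity_lt_Infty.
Qed.
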